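(* The provability logic $\mathsf{GL}$ is complete for finite transitive irreflexive provability models having necessitation and Löb's rule: if $A\in\mathcal L_\Box$ holds at every world of every such model, then $\mathsf{GL}\vdash A$.
   Context: $\mathsf{GL}$ is $\mathsf K$ (the smallest normal modal logic) plus $\Box A\to\Box\Box A$ and $\Box(\Box A\to A)\to\Box A$. Language $\mathcal L_\Box$: formulas built from atomic propositions and $\bot$ using $\to$ and a unary $\Box$. A formula is purely modal if it is a Boolean combination of formulas $\Box B$. A theory is a pair of a set of axioms and a set of inference rules (finitely many premises, one conclusion); $\mathsf T\vdash A$ means derivability from axioms by rules. A theory is classical if modus ponens is one of its rules and all classical tautologies are derivable. A provability pre-model is $\mathcal P=(W,\sqsubset,\{L_w\}_{w\in W^\sqsubset},V)$ with $W$ nonempty, $\sqsubset$ a binary relation on $W$, $V\subseteq W\times\mathrm{atoms}$, $W^\sqsubset=\{u:\exists v\,(v\sqsubset u)\}$, and a theory $L_w$ for each $w\in W^\sqsubset$. Satisfaction: atoms via $V$, $\bot$ never holds, $\to$ classical, $\mathcal P,w\Vdash\Box A$ iff $L_u\vdash A$ for all $u$ with $w\sqsubset u$. With $\sqsubset^+$ the transitive closure, $\mathcal P,w\Vdash^+A$ iff there is $u\sqsubset w$ with $\mathcal P,v\Vdash A$ for all $v$ such that $u\sqsubset^+v$. A provability model is a pre-model in which every $L_w$ is classical and which satisfies modal completeness: for every $w\in W^\sqsubset$ and purely modal $A$, $\mathcal P,w\Vdash^+A$ implies $L_w\vdash A$. Necessitation: every $L_w$ has the rule ''from $A$ infer $\Box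 A$''; Löb's rule: every $L_w$ has the rule ''from $\Box A\to A$ infer $A$''. *)

(* Defs.v *)
From Stdlib Require Import List Relations FinFun.
Import ListNotations.

Inductive form (Atom : Type) : Type :=
| Var (p : Atom)
| Bot
| Imp (A B : form Atom)
| Box (A : form Atom).

Arguments Var {Atom} p.
Arguments Bot {Atom}.
Arguments Imp {Atom} A B.
Arguments Box {Atom} A.

Declare Scope modal_scope.
Delimit Scope modal_scope with modal.
Bind Scope modal_scope with form.
Notation "A ⇒ B" := (Imp A B) (at level 55, right associativity) : modal_scope.
Notation "□ A" := (Box A) (at level 35, right associativity) : modal_scope.
Open Scope modal_scope.

(* Boxed formulas count as propositional atoms here, so [tautology] covers all
   substitution instances of propositional tautologies in the modal language. *)
Fixpoint eval {Atom : Type} (v : form Atom -> bool) (A : form Atom) : bool :=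
  match A with
  | Var _ | Box _ => v A
  | Bot => false
  | Imp B C => implb (eval v B) (eval v C)
  end.

Definition tautology {Atom : Type} (A : form Atom) : Prop :=
  forall v : form Atom -> bool, eval v A = true.

Inductive purely_modal {Atom : Type} : form Atom -> Prop :=
| pm_box B : purely_modal (□ B)
| pm_bot : purely_modal Bot
| pm_imp B C : purely_modal B -> purely_modal C -> purely_modal (B ⇒ C).

(* A rule is a list of premises with a conclusion; a schematic rule such as
   modus ponens is the set of all its instances. *)
Record theory (Atom : Type) : Type := Theory {
  axioms : form Atom -> Prop;
  rules : list (form Atom) -> form Atom -> Prop
}.

Arguments Theory {Atom} axioms rules.
Arguments axioms {Atom} t _.
Arguments rules {Atom} t _ _.

Inductive derivable {Atom : Type} (T : theory Atom) : form Atom -> Prop :=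
| der_axiom A : axioms T A -> derivable T A
| der_rule premises A :
    rules T premises A ->
    (forall B, In B premises -> derivable T B) ->
    derivable T A.

Notation "T ⊢ A" := (derivable T A) (at level 70, no associativity) : type_scope.

Definition has_modus_ponens {Atom : Type} (T : theory Atom) : Prop :=
  forall A B, rules T [A; A ⇒ B] B.

Definition has_necessitation {Atom : Type} (T : theory Atom) : Prop :=
  forall A, rules T [A] (□ A).

Definition has_loeb_rule {Atom : Type} (T : theory Atom) : Prop :=
  forall A, rules T [□ A ⇒ A] A.

Definition classical {Atom : Type} (T : theory Atom) : Prop :=
  has_modus_ponens T /\ forall A, tautology A -> T ⊢ A.

Inductive GL_axiom {Atom : Type} : form Atom -> Prop :=
| GL_taut A : tautology A -> GL_axiom A
| GL_K A B : GL_axiom (□ (A ⇒ B) ⇒ □ A ⇒ □ B)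
| GL_4 A : GL_axiom (□ A ⇒ □ □ A)
| GL_L A : GL_axiom (□ (□ A ⇒ A) ⇒ □ A).

Inductive GL_rule {Atom : Type} : list (form Atom) -> form Atom -> Prop :=
| GL_mp A B : GL_rule [A; A ⇒ B] B
| GL_nec A : GL_rule [A] (□ A).

(* All axioms are schemata, so closure under uniform substitution is automatic. *)
Definition GL (Atom : Type) : theory Atom := Theory GL_axiom GL_rule.

(* [th w] stands for L_w. It is a total function, but its values outside
   [has_pred] (the set W^⊏) are never used below. *)
Record premodel (Atom : Type) : Type := Premodel {
  world : Type;
  world_inhabited : inhabited world;
  acc : world -> world -> Prop;
  th : world -> theory Atom;
  val : world -> Atom -> Prop
}.

Arguments world {Atom} p.
Arguments world_inhabited {Atom} p.
Arguments acc {Atom} p _ _.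
Arguments th {Atom} p _.
Arguments val {Atom} p _ _.

Definition has_pred {Atom : Type} (P : premodel Atom) (u : world P) : Prop :=
  exists v, acc P v u.

Fixpoint sat {Atom : Type} (P : premodel Atom) (w : world P) (A : form Atom)
  : Prop :=
  match A with
  | Var p => val P w p
  | Bot => False
  | Imp B C => sat P w B -> sat P w C
  | Box B => forall u, acc P w u -> th P u ⊢ B
  end.

Definition sat_plus {Atom : Type} (P : premodel Atom) (w : world P)
    (A : form Atom) : Prop :=
  exists u, acc P u w /\
    forall v, clos_trans (world P) (acc P) u v -> sat P v A.

Definition modally_complete {Atom : Type} (P : premodel Atom) : Prop :=
  forall w, has_pred P w -> forall A, purely_modal A ->
    sat_plus P w A -> th P w ⊢ A.

Definition provability_model {Atom : Type} (P : premodel Atom) : Prop :=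
  (forall w, has_pred P w -> classical (th P w)) /\ modally_complete P.

Definition model_necessitation {Atom : Type} (P : premodel Atom) : Prop :=
  forall w, has_pred P w -> has_necessitation (th P w).

Definition model_loeb_rule {Atom : Type} (P : premodel Atom) : Prop :=
  forall w, has_pred P w -> has_loeb_rule (th P w).

Definition finite_model {Atom : Type} (P : premodel Atom) : Prop :=
  Finite (world P).

Definition transitive_model {Atom : Type} (P : premodel Atom) : Prop :=
  transitive (world P) (acc P).

Definition irreflexive_model {Atom : Type} (P : premodel Atom) : Prop :=
  forall w, ~ acc P w w.

(* Main.v *)
From Stdlib Require Import List Relations FinFun Wf_nat Lia Bool Classical ClassicalEpsilon.
Require Import Defs.
Import ListNotations.

(** A finite transitive irreflexive Kripke model becomes a provability model
    with the same satisfaction relation by letting [L_w] derive exactly the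
    formulas forced at [w] and at all successors of [w]; necessitation is then
    transitivity, and Löb's rule is converse well-foundedness. It remains to
    refute a non-theorem of GL in such a Kripke model. Its worlds choose [B] or
    [¬ B] for each subformula [B], and [y] is a successor of [x] when [y] is
    GL-consistent, [□ B] in [x] puts [B] and [□ B] in [y], and [y] contains some
    [□ C] that [x] does not. *)

Notation "¬ A" := (A ⇒ Bot) (at level 35, right associativity) : modal_scope.

Section FiniteStrictOrder.

Context {W : Type} (R : relation W).
Hypothesis R_trans : transitive W R.
Hypothesis R_irrefl : forall w, ~ R w w.

Lemma Acc_transp_of_listed_successors (l : list W) :
  forall w, (forall v, R w v -> In v l) -> Acc (transp W R) w.
Proof.
  induction l as [l IH] using (induction_ltof1 _ (@length W)).
  intros w Hl. constructor. intros v Hv.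
  destruct (in_split _ _ (Hl v Hv)) as [l1 [l2 ->]].
  apply (IH (l1 ++ l2)).
  - unfold ltof. rewrite !length_app. simpl. lia.
  - intros u Hu.
    destruct (in_elt_inv u v l1 l2 (Hl u (R_trans _ _ _ Hv Hu))) as [-> | Hin].
    + now destruct (R_irrefl v).
    + exact Hin.
Qed.

Lemma well_founded_transp_of_finite : Finite W -> well_founded (transp W R).
Proof.
  intros [l Hl] w. apply (Acc_transp_of_listed_successors l). auto.
Qed.

End FiniteStrictOrder.

Lemma truth_predicate_tautology {Atom : Type} (truth : form Atom -> Prop) :
  ~ truth Bot ->
  (forall B C, truth (B ⇒ C) <-> (truth B -> truth C)) ->
  forall A, tautology A -> truth A.
Proof.
  intros Hbot Himp A HA.
  set (v := fun B => if excluded_middle_informative (truth B) then true else false).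
  assert (Hv : forall B, v B = true <-> truth B).
  { intros B. unfold v. now destruct (excluded_middle_informative (truth B)). }
  assert (Heval : forall B, eval v B = true <-> truth B).
  { induction B as [p | | B IHB C IHC | B _]; try apply Hv; simpl; [easy |].
    now rewrite implb_true_iff, IHB, IHC, Himp. }
  apply Heval, HA.
Qed.

Section KripkeToProvability.

Context {Atom W : Type} (R : relation W) (V : W -> Atom -> Prop).

Fixpoint forces (w : W) (A : form Atom) : Prop :=
  match A with
  | Var p => V w p
  | Bot => False
  | Imp B C => forces w B -> forces w C
  | Box B => forall u, R w u -> forces u B
  end.

Definition forces_up (w : W) (A : form Atom) : Prop :=
  forall v, clos_refl W R w v -> forces v A.

Definition kripke_theory (w : W) : theory Atom :=
  Theory (forces_up w)
    (fun premises A => (forall B, In B premises -> forces_up w B) -> forces_up w A).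

Definition kripke_premodel (w0 : W) : premodel Atom :=
  Premodel Atom W (inhabits w0) R kripke_theory V.

Lemma derivable_kripke_theory w A : kripke_theory w ⊢ A <-> forces_up w A.
Proof.
  split.
  - induction 1 as [A HA | premises A Hr _ IH]; [exact HA | exact (Hr IH)].
  - exact (der_axiom (kripke_theory w) A).
Qed.

Lemma kripke_theory_classical w : classical (kripke_theory w).
Proof.
  split.
  - intros A B H v Hv.
    apply (H (A ⇒ B)); [simpl; auto | exact Hv |]. apply (H A); simpl; auto.
  - intros A HA. apply derivable_kripke_theory. intros v _.
    now apply (truth_predicate_tautology (forces v)).
Qed.

Hypothesis R_trans : transitive W R.

Lemma clos_refl_step w v u : clos_refl W R w v -> R v u -> R w u.
Proof. intros [v' Hv |]; [now apply R_trans | auto]. Qed.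

Lemma sat_kripke_premodel w0 A :
  forall w, sat (kripke_premodel w0) w A <-> forces w A.
Proof.
  induction A as [p | | B IHB C IHC | B IHB]; intros w; simpl.
  - easy.
  - easy.
  - now rewrite IHB, IHC.
  - split; intros H u Hu.
    + apply (derivable_kripke_theory u B); [now apply H | apply r_refl].
    + apply derivable_kripke_theory. intros v [v' Hv |]; [| now apply H].
      exact (H v' (R_trans _ _ _ Hu Hv)).
Qed.

Lemma kripke_provability_model w0 : provability_model (kripke_premodel w0).
Proof.
  split; [intros w _; apply kripke_theory_classical |].
  intros w _ A _ [u [Huw Hu]]. apply derivable_kripke_theory.
  intros v Hv. apply (sat_kripke_premodel w0), Hu.
  destruct Hv as [v Hv |]; apply t_step; [exact (R_trans _ _ _ Huw Hv) | exact Huw].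
Qed.

Lemma kripke_necessitation w0 : model_necessitation (kripke_premodel w0).
Proof.
  intros w _ A H v Hv u Hu. apply (H A); [now left |].
  apply r_step. exact (clos_refl_step w v u Hv Hu).
Qed.

Lemma kripke_loeb_rule w0 :
  well_founded (transp W R) -> model_loeb_rule (kripke_premodel w0).
Proof.
  intros Hwf w _ A H v. induction (Hwf v) as [v _ IH]. intros Hv.
  apply (H (□ A ⇒ A)); [now left | exact Hv |].
  intros u Hu. apply (IH u Hu), r_step. exact (clos_refl_step w v u Hv Hu).
Qed.

End KripkeToProvability.

Definition verifies {Atom : Type} (v : form Atom -> bool) (Γ : list (form Atom)) : Prop :=
  Forall (fun B => eval v B = true) Γ.

Lemma eval_fold_right_imp {Atom : Type} (v : form Atom -> bool) Γ A :
  eval v (fold_right Imp A Γ) = true <-> (verifies v Γ -> eval v A = true).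
Proof.
  unfold verifies. induction Γ as [| B Γ IH]; simpl.
  - intuition.
  - rewrite implb_true_iff, IH, Forall_cons_iff. tauto.
Qed.

Definition entails {Atom : Type} (T : theory Atom) (Γ : list (form Atom)) (A : form Atom)
  : Prop := T ⊢ fold_right Imp A Γ.

Notation "Γ ⊢[ T ] A" := (entails T Γ A) (at level 70, no associativity) : type_scope.

Definition consistent {Atom : Type} (T : theory Atom) (Γ : list (form Atom)) : Prop :=
  ~ Γ ⊢[T] Bot.

Section ClassicalTheory.

Context {Atom : Type} {T : theory Atom}.
Hypothesis T_classical : classical T.
Implicit Types (A B C : form Atom) (Γ Δ : list (form Atom)).

Lemma derivable_modus_ponens A B : T ⊢ A -> T ⊢ A ⇒ B -> T ⊢ B.
Proof.
  intros HA HAB. apply (der_rule T [A; A ⇒ B]); [apply (proj1 T_classical) |].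
  intros C [<- | [<- | []]]; assumption.
Qed.

Lemma derivable_of_entails Γ A : Forall (derivable T) Γ -> Γ ⊢[T] A -> T ⊢ A.
Proof.
  induction 1 as [| B Γ HB _ IH]; intros H; [exact H |].
  apply IH. exact (derivable_modus_ponens _ _ HB H).
Qed.

Lemma entails_of_derivable Γ A : T ⊢ A -> Γ ⊢[T] A.
Proof.
  intros HA. apply (derivable_modus_ponens A); [exact HA |].
  apply (proj2 T_classical). intros v. simpl.
  rewrite implb_true_iff, eval_fold_right_imp. auto.
Qed.

(* Propositional consequence is checked by truth tables rather than derived. *)
Lemma entails_propositional Γ Δ A :
  Forall (entails T Γ) Δ ->
  (forall v, verifies v Γ -> verifies v Δ -> eval v A = true) ->
  Γ ⊢[T] A.
Proof.
  intros HΔ HA. apply (derivable_of_entails (map (fun B => fold_right Imp B Γ) Δ)).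
  - now apply Forall_map.
  - apply (proj2 T_classical). intros v. rewrite !eval_fold_right_imp. intros H HΓ.
    apply HA; [exact HΓ |]. apply Forall_map in H.
    revert H. apply Forall_impl. intros B. rewrite eval_fold_right_imp. auto.
Qed.

Lemma entails_hyp Γ A : In A Γ -> Γ ⊢[T] A.
Proof.
  intros HA. apply (entails_propositional Γ []); [constructor |].
  intros v HΓ _. exact (proj1 (Forall_forall _ _) HΓ A HA).
Qed.

Lemma entails_cut Γ Δ A : Forall (entails T Γ) Δ -> Δ ⊢[T] A -> Γ ⊢[T] A.
Proof.
  intros HΔ HA. apply (entails_propositional Γ (fold_right Imp A Δ :: Δ)).
  - constructor; [now apply entails_of_derivable | exact HΔ].
  - intros v _ H. apply Forall_cons_iff in H as [H HvΔ].
    now apply eval_fold_right_imp in H.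
Qed.

Lemma entails_incl Γ Δ A : incl Γ Δ -> Γ ⊢[T] A -> Δ ⊢[T] A.
Proof.
  intros Hi. apply entails_cut, Forall_forall. intros B HB. now apply entails_hyp, Hi.
Qed.

Lemma entails_modus_ponens Γ A B : Γ ⊢[T] A -> Γ ⊢[T] A ⇒ B -> Γ ⊢[T] B.
Proof.
  intros HA HAB. apply (entails_cut Γ [A; A ⇒ B]); [now auto |].
  apply (proj2 T_classical). intros v. simpl. now destruct (eval v A), (eval v B).
Qed.

Lemma entails_deduction Γ A B : A :: Γ ⊢[T] B -> Γ ⊢[T] A ⇒ B.
Proof.
  intros H. apply (entails_propositional Γ [A ⇒ fold_right Imp B Γ]).
  - constructor; [now apply entails_of_derivable | constructor].
  - intros v HΓ HB. apply Forall_cons_iff in HB as [HB _]. revert HB. simpl.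
    rewrite !implb_true_iff, eval_fold_right_imp. auto.
Qed.

Lemma consistent_incl Γ Δ : incl Γ Δ -> consistent T Δ -> consistent T Γ.
Proof. intros Hi HΔ H. now apply HΔ, (entails_incl Γ). Qed.

Lemma consistent_not_entails_neg Γ A : consistent T Γ -> Γ ⊢[T] A -> ~ Γ ⊢[T] ¬ A.
Proof. intros HΓ HA HnA. exact (HΓ (entails_modus_ponens _ _ _ HA HnA)). Qed.

Lemma consistent_cons_neg Γ A : ~ Γ ⊢[T] A -> consistent T (¬ A :: Γ).
Proof.
  intros HA H. apply HA, (entails_cut Γ [¬ ¬ A]).
  - constructor; [now apply entails_deduction | constructor].
  - apply (proj2 T_classical). intros v. simpl. now destruct (eval v A).
Qed.

Lemma consistent_cons_or_cons_neg Γ A :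
  consistent T Γ -> consistent T (A :: Γ) \/ consistent T (¬ A :: Γ).
Proof.
  intros HΓ. destruct (classic (Γ ⊢[T] A)) as [HA | HA].
  - left. intros H. now apply (consistent_not_entails_neg _ _ HΓ HA), entails_deduction.
  - right. now apply consistent_cons_neg.
Qed.

End ClassicalTheory.

Definition normal {Atom : Type} (T : theory Atom) : Prop :=
  classical T /\ has_necessitation T /\
  forall A B, T ⊢ □ (A ⇒ B) ⇒ □ A ⇒ □ B.

Lemma entails_box {Atom : Type} {T : theory Atom} Γ A :
  normal T -> Γ ⊢[T] A -> map Box Γ ⊢[T] □ A.
Proof.
  intros [Hcl [Hnec HK]]. revert A. induction Γ as [| B Γ IH]; intros A HA.
  - apply (der_rule T [A]); [apply Hnec |]. now intros C [<- | []].
  - apply (entails_modus_ponens Hcl _ (□ B)); [apply (entails_hyp Hcl); now left |].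
    apply (entails_modus_ponens Hcl _ (□ (B ⇒ A))).
    + apply (entails_incl Hcl (map Box Γ)); [now apply incl_tl, incl_refl |].
      now apply IH, (entails_deduction Hcl).
    + apply (entails_of_derivable Hcl), HK.
Qed.

Lemma GL_classical (Atom : Type) : classical (GL Atom).
Proof.
  split; [constructor | intros A HA; now apply der_axiom, GL_taut].
Qed.

Lemma GL_normal (Atom : Type) : normal (GL Atom).
Proof.
  split; [apply GL_classical | split; [constructor |]].
  intros A B. apply der_axiom, GL_K.
Qed.

(* This is the box rule of the sequent calculus for GL; Löb's axiom discharges
   the diagonal hypothesis [□ A]. *)
Lemma GL_entails_box {Atom : Type} (Γ : list (form Atom)) A :
  □ A :: Γ ++ map Box Γ ⊢[GL Atom] A -> map Box Γ ⊢[GL Atom] □ A.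
Proof.
  pose proof (GL_classical Atom) as Hcl. intros H.
  apply (entails_modus_ponens Hcl _ (□ (□ A ⇒ A))).
  - apply (entails_deduction Hcl), (entails_box _ _ (GL_normal Atom)) in H.
    revert H. apply (entails_cut Hcl). rewrite map_app. apply Forall_app. split.
    + apply Forall_forall. intros B. apply (entails_hyp Hcl).
    + rewrite Forall_map. apply Forall_forall. intros B HB.
      apply (entails_modus_ponens Hcl _ B); [now apply (entails_hyp Hcl) |].
      apply in_map_iff in HB as [C [<- _]].
      apply (entails_of_derivable Hcl), der_axiom, GL_4.
  - apply (entails_of_derivable Hcl), der_axiom, GL_L.
Qed.

Fixpoint assignment {Atom : Type} (l : list (form Atom)) : Type :=
  match l with
  | [] => unit
  | _ :: l => bool * assignment l
  end.

Fixpoint literals {Atom : Type} {l : list (form Atom)} : assignment l -> list (form Atom) :=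
  match l with
  | [] => fun _ => []
  | A :: l => fun x => (if fst x then A else ¬ A) :: literals (snd x)
  end.

Notation "A ∈ x" := (In A (literals x)) (at level 70, no associativity) : type_scope.

Section Assignments.

Context {Atom : Type}.
Implicit Types (A B : form Atom) (l Γ : list (form Atom)).

Lemma assignment_finite l : Finite (assignment l).
Proof.
  induction l as [| A l [L HL]].
  - exists [tt]. intros []. now left.
  - exists (list_prod [true; false] L). intros [b x]. apply in_prod.
    + destruct b; simpl; auto.
    + apply HL.
Qed.

Lemma literals_total l (x : assignment l) A : In A l -> A ∈ x \/ ¬ A ∈ x.
Proof.
  induction l as [| B l IH]; simpl; [easy |]. destruct x as [b x]; simpl.
  intros [<- | HA].
  - destruct b; auto.
  - destruct (IH x HA); auto.
Qed.

Lemma box_in_literals l (x : assignment l) A : □ A ∈ x -> In (□ A) l.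
Proof.
  induction l as [| B l IH]; simpl; [easy |]. destruct x as [b x]; simpl.
  intros [HB | HA]; [left | right; now apply (IH x)].
  now destruct b.
Qed.

Context {T : theory Atom}.
Hypothesis T_classical : classical T.

Lemma lindenbaum l Γ :
  consistent T Γ -> exists x : assignment l, consistent T (literals x ++ Γ).
Proof.
  intros HΓ. induction l as [| A l [x Hx]]; [now exists tt |].
  destruct (consistent_cons_or_cons_neg T_classical _ A Hx) as [H | H].
  - now exists (true, x).
  - now exists (false, x).
Qed.

Lemma in_literals_iff_entails l (x : assignment l) Γ A :
  incl (literals x) Γ -> consistent T Γ -> In A l -> A ∈ x <-> Γ ⊢[T] A.
Proof.
  intros Hx HΓ Hl. split; intros HA.
  - now apply (entails_hyp T_classical), Hx.
  - destruct (literals_total l x A Hl) as [H | H]; [exact H |].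
    destruct (consistent_not_entails_neg T_classical Γ A HΓ HA).
    now apply (entails_hyp T_classical), Hx.
Qed.

Lemma imp_in_literals l (x : assignment l) A B :
  consistent T (literals x) -> In (A ⇒ B) l -> In A l -> In B l ->
  A ⇒ B ∈ x <-> (A ∈ x -> B ∈ x).
Proof.
  intros Hx HAB HA HB.
  assert (Hiff : forall C, In C l -> C ∈ x <-> literals x ⊢[T] C).
  { intros C. apply in_literals_iff_entails; [apply incl_refl | exact Hx]. }
  split.
  - rewrite !Hiff by assumption. intros H H'.
    exact (entails_modus_ponens T_classical _ _ _ H' H).
  - intros H. apply Hiff; [exact HAB |].
    destruct (literals_total l x A HA) as [HxA | HxA].
    + apply (entails_cut T_classical _ [B]).
      * constructor; [now apply Hiff, H | constructor].
      * apply (proj2 T_classical). intros v. simpl. now destruct (eval v A), (eval v B).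
    + apply (entails_cut T_classical _ [¬ A]).
      * constructor; [now apply (entails_hyp T_classical) | constructor].
      * apply (proj2 T_classical). intros v. simpl. now destruct (eval v A).
Qed.

End Assignments.

Definition unbox {Atom : Type} : list (form Atom) -> list (form Atom) :=
  flat_map (fun A => match A with Box B => [B] | _ => [] end).

Lemma in_unbox {Atom : Type} (Γ : list (form Atom)) A : In A (unbox Γ) <-> In (□ A) Γ.
Proof.
  unfold unbox. rewrite in_flat_map. split.
  - intros [[| | | B] [HB H]]; try easy. now destruct H as [<- | []].
  - intros HA. exists (□ A). simpl. auto.
Qed.

Lemma incl_map_box_unbox {Atom : Type} (Γ : list (form Atom)) : incl (map Box (unbox Γ)) Γ.
Proof. intros A HA. apply in_map_iff in HA as [B [<- HB]]. now apply in_unbox. Qed.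

Definition subformula_closed {Atom : Type} (l : list (form Atom)) : Prop :=
  (forall B C, In (B ⇒ C) l -> In B l /\ In C l) /\
  (forall B, In (□ B) l -> In B l).

Fixpoint subformulas {Atom : Type} (A : form Atom) : list (form Atom) :=
  A :: match A with
       | Imp B C => subformulas B ++ subformulas C
       | Box B => subformulas B
       | _ => []
       end.

Lemma subformulas_self {Atom : Type} (A : form Atom) : In A (subformulas A).
Proof. destruct A; now left. Qed.

Lemma subformulas_closed {Atom : Type} (A : form Atom) : subformula_closed (subformulas A).
Proof.
  pose proof (@subformulas_self Atom) as Hself.
  induction A as [p | | A1 [IHi1 IHb1] A2 [IHi2 IHb2] | A [IHi IHb]]; split; simpl.
  - now intros B C [|].
  - now intros B [|].
  - now intros B C [|].
  - now intros B [|].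
  - intros B C. rewrite !in_app_iff.
    intros [[= <- <-] | [H | H]]; [auto | apply IHi1 in H | apply IHi2 in H]; tauto.
  - intros B. rewrite !in_app_iff.
    intros [[=] | [H | H]]; [apply IHb1 in H | apply IHb2 in H]; tauto.
  - intros B C [[=] | H]. apply IHi in H. tauto.
  - intros B [[= <-] | H]; auto.
Qed.

Section CanonicalModel.

Context {Atom : Type} {l : list (form Atom)}.
Hypothesis l_closed : subformula_closed l.
Implicit Types (A B C : form Atom) (x y z : assignment l).

(* Inconsistent assignments stay in the type of worlds, which is thus trivially
   finite, but no world accesses them. *)
Definition canonical_acc x y : Prop :=
  consistent (GL Atom) (literals y) /\
  (forall B, □ B ∈ x -> B ∈ y /\ □ B ∈ y) /\
  exists C, □ C ∈ y /\ ~ □ C ∈ x.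

Definition canonical_val x (p : Atom) : Prop := Var p ∈ x.

Lemma canonical_acc_trans : transitive (assignment l) canonical_acc.
Proof.
  intros x y z [_ [Hxy [C [HyC HxC]]]] [Hz [Hyz _]]. split; [exact Hz | split].
  - intros B HB. now apply Hyz, Hxy.
  - exists C. split; [now apply Hyz | exact HxC].
Qed.

Lemma canonical_acc_irrefl x : ~ canonical_acc x x.
Proof. now intros [_ [_ [C [HC HnC]]]]. Qed.

Lemma canonical_successor x B :
  consistent (GL Atom) (literals x) -> In (□ B) l -> ~ □ B ∈ x ->
  exists y, canonical_acc x y /\ ~ B ∈ y.
Proof.
  pose proof (GL_classical Atom) as Hcl. intros Hx Hl HB.
  set (Γ := unbox (literals x)).
  assert (HΓ : consistent (GL Atom) (¬ B :: □ B :: Γ ++ map Box Γ)).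
  { apply (consistent_cons_neg Hcl). intros H. apply HB.
    apply (in_literals_iff_entails Hcl l x _ _ (incl_refl _) Hx Hl).
    apply (entails_incl Hcl _ _ _ (incl_map_box_unbox _)). now apply GL_entails_box. }
  destruct (lindenbaum Hcl l _ HΓ) as [y Hy]. exists y.
  assert (Hmem : forall A, In A l -> In A (□ B :: Γ ++ map Box Γ) -> A ∈ y).
  { intros A HA HAΓ.
    apply (in_literals_iff_entails Hcl l y _ _ (incl_appl _ (incl_refl _)) Hy HA).
    apply (entails_hyp Hcl), in_app_iff. right. now right. }
  split; [split; [| split] |].
  - revert Hy. apply (consistent_incl Hcl), incl_appl, incl_refl.
  - intros C HC. pose proof (box_in_literals l x C HC) as HCl.
    apply in_unbox in HC. split; apply Hmem; try now apply l_closed.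
    + right. apply in_app_iff. now left.
    + exact HCl.
    + right. apply in_app_iff. right. now apply in_map.
  - exists B. split; [apply Hmem; [exact Hl | now left] | exact HB].
  - intros HBy. apply (consistent_not_entails_neg Hcl _ B Hy);
      apply (entails_hyp Hcl), in_app_iff; [now left | right; now left].
Qed.

Lemma truth_lemma A x :
  In A l -> consistent (GL Atom) (literals x) ->
  forces canonical_acc canonical_val x A <-> A ∈ x.
Proof.
  revert x. induction A as [p | | B IHB C IHC | B IHB]; intros x Hl Hx; simpl.
  - easy.
  - split; [easy |]. intros H. now apply Hx, (entails_hyp (GL_classical Atom)).
  - destruct (proj1 l_closed B C Hl) as [HB HC].
    rewrite (imp_in_literals (GL_classical Atom) l x B C Hx Hl HB HC).
    now rewrite IHB, IHC.
  - pose proof (proj2 l_closed B Hl) as HB. split.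
    + intros H. apply NNPP. intros HxB.
      destruct (canonical_successor x B Hx Hl HxB) as [y [Hxy Hy]].
      apply Hy, IHB; [exact HB | apply Hxy | now apply H].
    + intros HxB y Hxy. apply IHB; [exact HB | apply Hxy | now apply Hxy].
Qed.

End CanonicalModel.

Lemma GL_kripke_completeness {Atom : Type} (A : form Atom) :
  (forall (W : Type) (R : relation W) (V : W -> Atom -> Prop),
     Finite W -> transitive W R -> (forall w, ~ R w w) ->
     forall w, forces R V w A) ->
  GL Atom ⊢ A.
Proof.
  pose proof (GL_classical Atom) as Hcl. intros Hvalid. apply NNPP. intros HA.
  assert (HnA : consistent (GL Atom) [¬ A]) by now apply (consistent_cons_neg Hcl).
  destruct (lindenbaum Hcl (subformulas A) _ HnA) as [x Hx].
  apply (consistent_not_entails_neg Hcl _ A Hx);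
    apply (entails_hyp Hcl), in_app_iff; [left | now right; left].
  apply (truth_lemma (subformulas_closed A)).
  - apply subformulas_self.
  - revert Hx. apply (consistent_incl Hcl), incl_appl, incl_refl.
  - apply Hvalid.
    + apply assignment_finite.
    + apply canonical_acc_trans.
    + apply canonical_acc_irrefl.
Qed.

Theorem theorem3p17 (Atom : Type) (A : form Atom) :
  (forall P : premodel Atom,
     provability_model P ->
     finite_model P -> transitive_model P -> irreflexive_model P ->
     model_necessitation P -> model_loeb_rule P ->
     forall w : world P, sat P w A) ->
  GL Atom ⊢ A.
Proof.
  intros Hvalid. apply GL_kripke_completeness.
  intros W R V Hfin Htrans Hirrefl w.
  apply (sat_kripke_premodel R V Htrans w), Hvalid.
  - now apply kripke_provability_model.
  - exact Hfin.
  - exact Htrans.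
  - exact Hirrefl.
  - now apply kripke_necessitation.
  - now apply kripke_loeb_rule, well_founded_transp_of_finite.
Qed.
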